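(* Let $(X,\rho)$ be a semi-normed space and let $1\le p<\infty$. Then every rapidly Cauchy sequence in $\mathcal{U}^p_\rho([a,b];X)$ is pointwise Cauchy almost everywhere on $[a,b]$. Furthermore, if $X$ is sequentially complete, then $\mathcal{U}^p_\rho([a,b];X)$ is sequentially complete.
   Context: $[a,b]$ is a compact interval and $(X,\rho)$ is a real vector space with a semi-norm $\rho$. A gauge on $[a,b]$ is a function $\delta:[a,b]\to(0,\infty)$. A tagged partition of $[a,b]$ is a finite collection $D=\{([u_i,v_i],t_i):1\le i\le n\}$ of non-overlapping non-degenerate closed intervals with union $[a,b]$ and tags $t_i\in[u_i,v_i]$; it is $\delta$-fine if $[u_i,v_i]\subseteq(t_i-\delta(t_i),t_i+\delta(t_i))$ for every $i$. For such $D$, $(D)\sum\varphi(t)(v-u)$ denotes $\sum_{i=1}^n\varphi(t_i)(v_i-u_i)$. For $f:[a,b]\to X$ and $1\le p<\infty$, $$\mu^p_\rho(f,[a,b])=\inf_{\text{gauge }\delta}\ \sup\Big\{(D)\sum \rho(f(t))^p\,(v-u): D\text{ is a }\delta\text{-fine tagged partition of }[a,b]\Big\}\in[0,\infty].$$ $\mathcal{U}^p_\rho([a,b];X)$ is the set of all $f:[a,b]\to X$ with $\mu^p_\rho(f,[a,b])<\infty$, equipped with the semi-norm $\|f\|_{\mathcal{U}^p_\rho}=\mu^p_\rho(f,[a,b])^{1/p}$ (functions are not identified a.e.). A semi-normed space is regarded as a pseudo-metric space with $d(u,v)$ equal to the semi-norm of $u-v$. In a pseudo-metric space, $\{u_n\}$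 converges to $u$ if $d(u_n,u)\to0$; it is Cauchy if for every $\varepsilon>0$ there is $N$ with $d(u_m,u_n)<\varepsilon$ for all $m,n\ge N$; it is rapidly Cauchy if there is a convergent series $\sum_{k=1}^\infty\varepsilon_k$ of positive numbers with $d(u_{k+1},u_k)<\varepsilon_k^2$ for all $k\in\mathbb{N}$. The space is sequentially complete if every Cauchy sequence converges to some element of it. A sequence of functions $f_n:[a,b]\to X$ is pointwise Cauchy a.e. if there is a set $E\subseteq[a,b]$ of Lebesgue measure zero such that $\{f_n(t)\}$ is Cauchy in $(X,\rho)$ for every $t\in[a,b]\setminus E$. *)

(* Defs.v *)
From HB Require Import structures.
From mathcomp Require Import all_boot all_order all_algebra.
From mathcomp Require Import all_classical all_reals all_analysis.

Set Implicit Arguments.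
Unset Strict Implicit.
Unset Printing Implicit Defensive.

Import Order.TTheory GRing.Theory Num.Theory.
Import numFieldNormedType.Exports.
Local Open Scope classical_set_scope.
Local Open Scope ring_scope.

Definition seminorm (R : realType) (X : lmodType R) (rho : X -> R) : Prop :=
  [/\ forall x, 0 <= rho x,
      forall x y, rho (x + y) <= rho x + rho y
    & forall (c : R) x, rho (c *: x) = `|c| * rho x].

Section PseudoMetric.
Context (R : realType) (T : Type) (d : T -> T -> R).
Implicit Types (u : nat -> T) (l : T).

Definition seq_converges u l : Prop := (fun n => d (u n) l) @ \oo --> (0 : R).

Definition seq_cauchy u : Prop :=
  forall e : R, 0 < e ->
    exists N : nat, forall m n : nat, (N <= m)%N -> (N <= n)%N ->
      d (u m) (u n) < e.

Definition seq_rapidly_cauchy u : Prop :=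
  exists eps : nat -> R,
    [/\ forall k, 0 < eps k, cvgn (series eps)
      & forall k, d (u k.+1) (u k) < eps k ^+ 2].

Definition sequentially_complete : Prop :=
  forall u, seq_cauchy u -> exists l, seq_converges u l.

End PseudoMetric.

Definition seminorm_dist (R : realType) (X : lmodType R) (rho : X -> R)
  (x y : X) : R := rho (x - y).

(* Below, `[a, b] and the set Up are also used as types, through the coercion
   set_type; in particular a function on [a, b] has no values outside [a, b]. *)
Section GaugeSpaces.
Context (R : realType) (a b : R).

Definition gauge (delta : `[a, b]%classic -> R) : Prop :=
  forall t, 0 < delta t.

Record tagged_family := TaggedFamily {
  pieces : nat;
  left_end : 'I_pieces -> R;
  right_end : 'I_pieces -> R;
  tag_of : 'I_pieces -> `[a, b]%classic }.

Implicit Types (D : tagged_family) (delta : `[a, b]%classic -> R).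

(* Two non-degenerate closed intervals are non-overlapping when their interiors
   are disjoint. *)
Definition tagged_partition D : Prop :=
  [/\ forall i : 'I_(pieces D), left_end i < right_end i,
      forall i j : 'I_(pieces D), i != j ->
        `]left_end i, right_end i[%classic `&`
          `]left_end j, right_end j[%classic = set0,
      \bigcup_(i in [set: 'I_(pieces D)]) `[left_end i, right_end i]%classic =
        `[a, b]%classic
    & forall i : 'I_(pieces D),
        `[left_end i, right_end i]%classic (\val (tag_of i))].

Definition fine_for delta D : Prop :=
  forall i : 'I_(pieces D),
    `[left_end i, right_end i]%classic `<=`
      `](\val (tag_of i) - delta (tag_of i)),
        (\val (tag_of i) + delta (tag_of i))[%classic.

Definition riemann_sum (phi : `[a, b]%classic -> R) D : R :=
  \sum_(i < pieces D) phi (tag_of i) * (right_end i - left_end i).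

Context (X : lmodType R) (rho : X -> R) (p : R).
Implicit Types f g : `[a, b]%classic -> X.

Definition mu_p f : \bar R :=
  ereal_inf [set s | exists2 delta, gauge delta & s =
    ereal_sup [set (riemann_sum (fun t => rho (f t) `^ p) D)%:E
              | D in [set D | tagged_partition D /\ fine_for delta D]]].

Definition Up : set (`[a, b]%classic -> X) := [set f | (mu_p f < +oo)%E].

(* For a < b and p >= 1, mu_p f >= 0, because delta-fine tagged partitions
   exist for every gauge, and Up is a linear subspace; so Up_dist applies fine
   to finite values only. *)
Definition Up_norm f : R := fine (mu_p f) `^ p^-1.

Definition Up_dist (f g : Up) : R := Up_norm (fun t => \val f t - \val g t).

Definition pointwise_cauchy_ae (f : nat -> `[a, b]%classic -> X) : Prop :=
  exists E : set R,
    [/\ E `<=` `[a, b]%classic, (@lebesgue_measure R).-negligible E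
      & forall t : `[a, b]%classic, ~ E (\val t) ->
          seq_cauchy (seminorm_dist rho) (fun n => f n t)].

End GaugeSpaces.

Arguments Up {R} a b {X} rho p.
Arguments Up_dist {R} a b {X} rho p f g.

(* Main.v *)
Require Import Defs.
From HB Require Import structures.
From mathcomp Require Import all_boot all_order all_algebra.
From mathcomp Require Import all_classical all_reals all_analysis.
From mathcomp Require Import lra.

Import Order.TTheory GRing.Theory Num.Theory.
Import numFieldNormedType.Exports.
Local Open Scope classical_set_scope.
Local Open Scope ring_scope.

(* mu_p is an upper gauge integral of rho (f t) ^ p; it needs no measurability.
   A subfamily of a fine partition can be completed by Cousin's lemma, which
   makes this upper integral countably subadditive, and makes it dominate
   Lebesgue outer measure on superlevel sets.

   Let h_k = rho (f_(k+1) - f_k) for a rapidly Cauchy sequence with constants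
   eps_k. By Chebyshev the sets {h_k >= eps_k} have outer measure at most eps_k
   for large k, so by Borel-Cantelli h_k < eps_k eventually at almost every
   point, and the sequence is Cauchy there.

   For completeness, pass to a subsequence g_k with eps_k = 2^-(k+1). Let f be
   its pointwise limit where it converges. Since the eps_j add up to at most 1,
   rho (g_K - f) is at most twice the supremum over j >= K of h_j / eps_j at
   those points, so countable subadditivity of the p-th powers bounds the norm
   of g_K - f (Minkowski's inequality is not needed). The points of divergence
   have upper integral 0, again by subadditivity. *)

(** * Tagged partitions of subintervals: gluing, Cousin's lemma, completion *)

Section GaugePartitions.
Context {R : realType} {a b : R}.
Implicit Types (D : tagged_family a b) (delta : `[a, b]%classic -> R).
Implicit Types (c d : R) (phi psi : `[a, b]%classic -> R).

(* tagged_partition D is partition_of a b D; the tags range over [a, b]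
   also when the pieces only fill [c, d], so that one gauge serves for all
   subintervals. *)
Definition partition_of c d D : Prop :=
  [/\ forall i : 'I_(pieces D), left_end i < right_end i,
      forall i j : 'I_(pieces D), i != j ->
        `]left_end i, right_end i[%classic `&`
          `]left_end j, right_end j[%classic = set0,
      \bigcup_(i in [set: 'I_(pieces D)]) `[left_end i, right_end i]%classic =
        `[c, d]%classic
    & forall i : 'I_(pieces D),
        `[left_end i, right_end i]%classic (\val (tag_of i))].

Lemma partition_of_sub {c d D} (i : 'I_(pieces D)) : partition_of c d D ->
  c <= left_end i /\ right_end i <= d.
Proof.
move=> [lt_lr _ cover _]; have le_lr := ltW (lt_lr i).
suff [+ +] : `[c, d]%classic (left_end i) /\ `[c, d]%classic (right_end i).
  by rewrite /= !in_itv /= => /andP[-> _] /andP[_ ->].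
by rewrite -cover; split; exists i => //=; rewrite in_itv /= lexx le_lr.
Qed.

Lemma sub_itv_oo (c d l r : R) : c <= l -> r <= d ->
  `]l, r[%classic `<=` `]c, d[%classic.
Proof.
move=> cl rd x /=; rewrite !in_itv /= => /andP[lx xr].
by rewrite (le_lt_trans cl lx) (lt_le_trans xr rd).
Qed.

(** The glued pieces are indexed by pairs of a block and a piece in its family. Pieces from
    different blocks do not overlap, because each lies inside its block. *)
Lemma glue_partitions c d delta (I : finType) (l r : I -> R)
    (F : I -> tagged_family a b) :
  (forall i j, i != j ->
     `]l i, r i[%classic `&` `]l j, r j[%classic = set0) ->
  \bigcup_(i in [set: I]) `[l i, r i]%classic = `[c, d]%classic ->
  (forall i, partition_of (l i) (r i) (F i)) ->
  (forall i, fine_for delta (F i)) ->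
  exists D, [/\ partition_of c d D, fine_for delta D
    & forall phi, riemann_sum phi D = \sum_i riemann_sum phi (F i)].
Proof.
move=> disj cover part fine.
pose K : finType := {i : I & 'I_(pieces (F i))}.
pose D := @TaggedFamily R a b #|K|
  (fun k => left_end (tagged (enum_val k)))
  (fun k => right_end (tagged (enum_val k)))
  (fun k => tag_of (tagged (enum_val k))).
exists D; split.
- split=> [k|k1 k2|| k] /=.
  + by have [+ _ _ _] := part (tag (enum_val k)); exact.
  + rewrite -(inj_eq enum_val_inj).
    case: (enum_val k1) (enum_val k2) => [i1 j1] [i2 j2] /= neq.
    have [eq_i|neq_i] := eqVneq i1 i2; last first.
      rewrite -subset0 -(disj _ _ neq_i).
      have [l1 r1] := partition_of_sub j1 (part i1).
      have [l2 r2] := partition_of_sub j2 (part i2).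
      by apply: setISS; apply: sub_itv_oo.
    subst i2; have [_ + _ _] := part i1; apply.
    by apply: contra_neq neq => ->.
  + rewrite -cover; apply/seteqP; split=> x.
      move=> [k _]; case: (enum_val k) => [i j] /= xj; exists i => //.
      by have [_ _ <- _] := part i; exists j.
    move=> [i _]; have [_ _ <- _] := part i.
    move=> [j _ xj]; exists (enum_rank (Tagged _ j : K)) => //.
    by rewrite /= enum_rankK.
  + by have [_ _ _] := part (tag (enum_val k)); exact.
- by move=> k; exact: fine.
- move=> phi; rewrite /riemann_sum sig_big_dep /=.
  rewrite (reindex (@enum_val K (mem K))) //.
  exact/onW_bij/enum_val_bij.
Qed.

Lemma partition_single {c d delta} (t : `[a, b]%classic) :
  c < d -> `[c, d]%classic (\val t) ->
  `[c, d]%classic `<=` `](\val t - delta t), (\val t + delta t)[%classic ->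
  exists D, [/\ partition_of c d D, fine_for delta D
    & forall phi, riemann_sum phi D = phi t * (d - c)].
Proof.
move=> cd ct fine.
exists (@TaggedFamily R a b 1 (fun=> c) (fun=> d) (fun=> t)).
split=> [||phi]; last by rewrite /riemann_sum big_ord1.
- split=> //= [i j|]; first by rewrite (ord1 i) (ord1 j) eqxx.
  by apply/seteqP; split=> [x [] //|x cx]; exists ord0.
- by move=> i /=.
Qed.

(** Supremum argument: a single piece tagged at the supremum [s] of the reachable right endpoints
    carries a fine partition past [s], unless [d] is reached. *)
Lemma cousin {c d delta} : gauge delta -> a <= c -> c < d -> d <= b ->
  exists2 D, partition_of c d D & fine_for delta D.
Proof.
move=> delta_gt0 ac cd db.
(* The clause [x = c] makes the set nonempty: [[c, c]] has no partition into non-degenerate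
   pieces. *)
pose reach := [set x | c <= x <= d /\ (x = c \/
  exists2 D, partition_of c x D & fine_for delta D)].
suff: reach d.
  by move=> [_ [dc|//]]; rewrite dc ltxx in cd.
have reach_c : reach c by split; [rewrite lexx ltW|left].
have ub_d : ubound reach d by move=> x [/andP[]].
have has_sup_reach : has_sup reach by split; [exists c|exists d].
pose s := sup reach.
have le_s x : reach x -> x <= s by apply: ub_le_sup; exists d.
have cs : c <= s by exact: le_s.
have sd : s <= d by apply: ge_sup => //; exists c.
have ab_s : s \in `[a, b]%classic.
  by apply/mem_set; rewrite /= in_itv /= (le_trans ac cs) (le_trans sd db).
pose t : `[a, b]%classic := exist _ s ab_s.
have dt := delta_gt0 t.
have [x reach_x sx] := sup_adherent dt has_sup_reach.
have xs := le_s _ reach_x.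
(* Half the gauge keeps [y] strictly inside the neighbourhood of [s]. Once [y] is reachable,
   [y <= s], which is possible only if the minimum is [d]. *)
pose y := Num.min d (s + delta t / 2).
have sy : s <= y by rewrite le_min sd /= lerDl divr_ge0 // ltW.
have yd : y <= d by rewrite ge_min lexx.
have ysd : y < s + delta t.
  by apply: (@le_lt_trans _ _ (s + delta t / 2));
    rewrite ?ge_min ?lexx ?orbT // ltrD2l; lra.
have reach_y : reach y.
  have [yx|xy] := leP y x.
    by have -> : y = x by apply/le_anti; rewrite yx (le_trans xs sy).
  have [/andP[cx _] hx] := reach_x.
  split; first by rewrite (le_trans cs sy) yd.
  right.
  have [D [D1 D2 _]] : exists D, [/\ partition_of x y D, fine_for delta D
      & forall phi, riemann_sum phi D = phi t * (y - x)].
    apply: partition_single => //=.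
      by rewrite in_itv /= xs sy.
    move=> z /=; rewrite !in_itv /= -/s => /andP[xz zy].
    by rewrite (lt_le_trans sx xz) (le_lt_trans zy ysd).
  case: hx => [xc|[E E1 E2]]; first by rewrite -xc; exists D.
  have [] := @glue_partitions c y delta bool
    (fun i => if i then c else x) (fun i => if i then x else y)
    (fun i => if i then E else D).
  - have disj : `]c, x[%classic `&` `]x, y[%classic = set0 :> set R.
      apply/seteqP; split=> // z [] /=; rewrite !in_itv /=.
      by move=> /andP[_ zx] /andP[/(lt_trans zx)]; rewrite ltxx.
    by move=> [] [] // _; rewrite // setIC.
  - apply/seteqP; split=> z /=.
      by move=> [[] _ /=]; rewrite !in_itv /= => /andP[lz zr];
        rewrite (le_trans _ lz) ?(le_trans zr) // ltW.
    rewrite in_itv /= => /andP[cz zy].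
    have [zx|xz] := leP z x; [exists true|exists false] => //=;
      by rewrite in_itv /= ?cz ?zy ?zx ?(ltW xz).
  - by case.
  - by case.
  - by move=> G [G1 G2 _]; exists G.
have ys := le_s _ reach_y.
suff <- : y = d by [].
apply/le_anti; rewrite yd /=; apply: le_trans sy.
by move: ys; rewrite ge_min gerDl (leNgt (_ / _)) divr_gt0 // orbF.
Qed.

(* Keep the pieces selected by S, with new tags, and let Cousin's lemma fill in
   the others. *)
Lemma refine_partition {delta D} (S : pred 'I_(pieces D))
    (tag : 'I_(pieces D) -> `[a, b]%classic) :
  gauge delta -> partition_of a b D ->
  (forall i, S i ->
     `[left_end i, right_end i]%classic (\val (tag i)) /\
     `[left_end i, right_end i]%classic `<=`
       `](\val (tag i) - delta (tag i)),
         (\val (tag i) + delta (tag i))[%classic) ->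
  exists D', [/\ partition_of a b D', fine_for delta D'
    & forall phi, (forall t, 0 <= phi t) ->
      \sum_(i | S i) phi (tag i) * (right_end i - left_end i) <=
        riemann_sum phi D'].
Proof.
move=> delta_gt0 part fine.
have riemann_ge0 phi c d E : (forall t, 0 <= phi t) -> partition_of c d E ->
    0 <= riemann_sum phi E.
  move=> phi0 [lr _ _ _]; apply: sumr_ge0 => i _.
  by rewrite mulr_ge0 // subr_ge0 ltW.
have local i : exists E, [/\ partition_of (left_end i) (right_end i) E,
    fine_for delta E & forall phi, S i ->
      phi (tag i) * (right_end i - left_end i) = riemann_sum phi E].
  have [lr _ _ _] := part.
  have [Si|nSi] := boolP (S i).
    have [ti fi] := fine _ Si.
    have [E [E1 E2 E3]] := partition_single _ (lr i) ti fi.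
    by exists E; split=> // phi _; rewrite E3.
  have [al rb] := partition_of_sub i part.
  have [E E1 E2] := cousin delta_gt0 al (lr i) rb.
  by exists E; split=> // phi Si; rewrite Si in nSi.
have [F hF] := choice local.
have [_ disj cover _] := part.
have [||D' [D'1 D'2 sumD']] :=
  glue_partitions a b delta _ _ _ F disj cover.
- by move=> i; have [] := hF i.
- by move=> i; have [] := hF i.
exists D'; split=> // phi phi0.
rewrite sumD' big_mkcond; apply: ler_sum => i _.
have [partF _ eqF] := hF i.
case: ifP => [Si|_]; first by rewrite eqF.
exact: riemann_ge0 partF.
Qed.

End GaugePartitions.

(** * Upper gauge integrals and the measure of superlevel sets *)

Section UpperSums.
Context {R : realType} {a b : R}.
Implicit Types (phi psi : `[a, b]%classic -> R) (c : R).

(** A bound on the upper gauge integral witnessed by one gauge, in real numbers only. It lies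
    between [mu_p < c] and [mu_p <= c] when [phi] is the [p]-th power of the semi-norm. *)
Definition upper_sums_le phi c : Prop :=
  exists2 delta, gauge delta & forall D : tagged_family a b,
    tagged_partition D -> fine_for delta D -> riemann_sum phi D <= c.

Lemma le_riemann_sum phi psi (D : tagged_family a b) : tagged_partition D ->
  (forall t, phi t <= psi t) -> riemann_sum phi D <= riemann_sum psi D.
Proof.
move=> [lr _ _ _] le_phi; apply: ler_sum => i _.
by rewrite ler_wpM2r // subr_ge0 ltW.
Qed.

Lemma upper_sums_le_trans phi psi c d : (forall t, phi t <= psi t) -> c <= d ->
  upper_sums_le psi c -> upper_sums_le phi d.
Proof.
move=> le_phi cd [delta delta_gt0 sum_le]; exists delta => // D partD fineD.
apply: le_trans (le_riemann_sum _ _ _ partD le_phi) _.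
exact: le_trans (sum_le _ partD fineD) cd.
Qed.

Lemma upper_sums_leZ k phi c : 0 <= k ->
  upper_sums_le phi c -> upper_sums_le (fun t => k * phi t) (k * c).
Proof.
move=> k0 [delta delta_gt0 sum_le]; exists delta => // D partD fineD.
have -> : riemann_sum (fun t => k * phi t) D = k * riemann_sum phi D.
  by rewrite /riemann_sum mulr_sumr; apply: eq_bigr => i _; rewrite mulrA.
by rewrite ler_wpM2l // sum_le.
Qed.

Lemma upper_sums_leD phi psi c d : upper_sums_le phi c -> upper_sums_le psi d ->
  upper_sums_le (fun t => phi t + psi t) (c + d).
Proof.
move=> [d1 d1_gt0 sum1] [d2 d2_gt0 sum2].
exists (fun t => Num.min (d1 t) (d2 t)).
  by move=> t; rewrite lt_min d1_gt0 d2_gt0.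
move=> D partD fineD.
have -> : riemann_sum (fun t => phi t + psi t) D =
    riemann_sum phi D + riemann_sum psi D.
  by rewrite /riemann_sum -big_split; apply: eq_bigr => i _; rewrite mulrDl.
apply: lerD; [apply: sum1 | apply: sum2] => // i x xi;
  have := fineD i x xi; rewrite /= !in_itv /= => /andP[lx xr].
  rewrite (le_lt_trans _ lx) ?(lt_le_trans xr) //.
  + by rewrite lerD2l ge_min lexx.
  + by rewrite lerB // ge_min lexx.
rewrite (le_lt_trans _ lx) ?(lt_le_trans xr) //.
+ by rewrite lerD2l ge_min lexx orbT.
+ by rewrite lerB // ge_min lexx orbT.
Qed.

(* Countable subadditivity of the upper gauge integral, without measurability:
   use the gauge of psi j at the points where psi j dominates phi. The pieces
   tagged there form part of a full partition, fine for the gauge of psi j. *)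
Lemma upper_sums_le_countable phi (psi : nat -> `[a, b]%classic -> R)
    (c : nat -> R) C :
  (forall j t, 0 <= psi j t) ->
  (forall t, exists j, phi t <= psi j t) ->
  (forall j, upper_sums_le (psi j) (c j)) ->
  (forall n, \sum_(j < n) c j <= C) ->
  upper_sums_le phi C.
Proof.
move=> psi_ge0 dom psi_le sum_c.
have [J phi_le] := choice dom.
have {psi_le} [delta hdelta] : {delta | forall j, gauge (delta j) /\
    forall D : tagged_family a b, tagged_partition D -> fine_for (delta j) D ->
      riemann_sum (psi j) D <= c j}.
  have H j : exists d, gauge d /\ forall D : tagged_family a b,
      tagged_partition D -> fine_for d D -> riemann_sum (psi j) D <= c j.
    by have [d d1 d2] := psi_le j; exists d.
  by have [d hd] := choice H; exists d.
exists (fun t => delta (J t) t).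
  by move=> t; have [] := hdelta (J t).
move=> D partD fineD; have [lr _ _ tagD] := partD.
(* Only finitely many tags occur in [D], so only finitely many of the [psi j] are involved. *)
pose N := (\max_(i < pieces D) J (tag_of i))%N.+1.
have J_lt (i : 'I_(pieces D)) : (J (tag_of i) < N)%N.
  by rewrite ltnS (leq_bigmax (F := fun i => J (tag_of i))).
apply: le_trans (sum_c N).
have partial_le (j : 'I_N) :
    \sum_(i < pieces D | J (tag_of i) == j)
      psi j (tag_of i) * (right_end i - left_end i) <= c j.
  have [d_gt0 d_le] := hdelta j.
  have [] := refine_partition (fun i => J (tag_of i) == j) (@tag_of _ _ _ D)
    d_gt0 partD.
    by move=> i /eqP Ji; split => //; have := fineD i; rewrite Ji.
  move=> D' [partD' fineD' /(_ _ (psi_ge0 j)) /le_trans]; apply.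
  exact: d_le.
apply: le_trans (ler_sum _ (fun j _ => partial_le j)).
(* After the exchange, the inner sum at a piece has the single index [J] of its tag. *)
rewrite (exchange_big_dep xpredT) //=; apply: ler_sum => i _.
rewrite (bigD1 (Ordinal (J_lt i))) //= big1
  => [|j /andP[/eqP Jj /eqP[]]]; last first.
  exact/val_inj.
by rewrite addr0 ler_wpM2r // subr_ge0 ltW.
Qed.

(** In a partition fine for the constant [r], any two points of a piece are less than [2 * r] apart.
    A point [t] of the piece with [2 * r <= delta t] can thus serve as its tag, and if [1 <= phi t]
    the length is at most its term in the Riemann sum. *)
Lemma superlevel_cover phi c (delta : `[a, b]%classic -> R) (r : R) :
  a < b -> (forall t, 0 <= phi t) -> gauge delta -> 0 < r ->
  (forall D : tagged_family a b, tagged_partition D -> fine_for delta D ->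
    riemann_sum phi D <= c) ->
  exists A : set R, [/\ measurable A, (lebesgue_measure A <= c%:E)%E &
    forall t, 1 <= phi t -> 2 * r <= delta t -> A (\val t)].
Proof.
move=> ab phi_ge0 delta_gt0 r_gt0 sum_le.
have [D partD fineD] : exists2 D : tagged_family a b,
    tagged_partition D & fine_for (fun=> r) D.
  by apply: cousin => // t.
pose hit (i : 'I_(pieces D)) t := [/\
  `[left_end i, right_end i]%classic (\val t),
  1 <= phi t & 2 * r <= delta t].
pose S i := `[< exists t, hit i t >].
have [tag htag] : {tag | forall i, S i -> hit i (tag i)}.
  have H i : exists t, S i -> hit i t.
    have [[t ht]|nex] := pselect (exists t, hit i t); first by exists t.
    by exists (tag_of i) => /asboolP.
  by have [tag htag] := choice H; exists tag.
have [] := refine_partition S tag delta_gt0 partD.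
  move=> i /htag [ti _ le_delta]; split=> // x xi.
  have := fineD i _ xi; have := fineD i _ ti.
  rewrite /= !in_itv /= => /andP[? ?] /andP[? ?]; apply/andP; split; lra.
move=> D' [partD' fineD' le_sum].
have [lr _ cover _] := partD.
exists (\big[setU/set0]_(i | S i) `[left_end i, right_end i]%classic).
have [mA leA] : measurable (\big[setU/set0]_(i | S i)
      `[left_end i, right_end i]%classic : set R) /\
    (lebesgue_measure (\big[setU/set0]_(i | S i)
      `[left_end i, right_end i]%classic : set R) <=
      (\sum_(i | S i) (right_end i - left_end i))%:E)%E.
  (* Measurability is carried along because subadditivity of the measure asks for it at each
     union. *)
  apply: (big_ind2 (fun (A : set R) (x : R) =>
    measurable A /\ (lebesgue_measure A <= x%:E)%E)).
  - by rewrite measure0.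
  - move=> A x B y [mA Ax] [mB By]; split; first exact: measurableU.
    by rewrite EFinD; apply: le_trans (leeD Ax By); exact: measureU2.
  - by move=> i _; rewrite lebesgue_measure_itv /= lte_fin lr.
split=> //.
- apply: le_trans leA _; rewrite lee_fin.
  apply: le_trans (le_trans (le_sum phi phi_ge0) (sum_le _ partD' fineD')).
  apply: ler_sum => i /htag[_ phi1 _].
  by rewrite ler_peMl // subr_ge0 ltW.
- move=> t phi1 le_delta.
  have [i _ ti] : (\bigcup_(i in [set: 'I_(pieces D)])
    `[left_end i, right_end i]%classic) (\val t).
    by rewrite cover; exact: set_mem (valP t).
  by rewrite (bigD1 i) /=; [left | apply/asboolP; exists t].
Qed.

(** The covers [A n] for [r = 1 / (n + 1)] are combined into their lower limit. A point of the
    superlevel set lies in [A n] once [2 / (n + 1)] is below its gauge; each [F m] is inside [A m],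
    so continuity from below keeps the bound [c]. *)
Lemma superlevel_measurable_cover phi c :
  a < b -> (forall t, 0 <= phi t) -> upper_sums_le phi c ->
  exists B : set R, [/\ measurable B, (lebesgue_measure B <= c%:E)%E &
    forall t, 1 <= phi t -> B (\val t)].
Proof.
move=> ab phi_ge0 [delta delta_gt0 sum_le].
have [A hA] := choice (fun n : nat => superlevel_cover _ _ _ n.+1%:R^-1 ab
  phi_ge0 delta_gt0 (ltac:(by rewrite invr_gt0)) sum_le).
pose F m := \bigcap_(n >= m) A n.
have mF m : measurable (F m).
  by apply: bigcap_measurableType => n _; have [] := hA n.
exists (\bigcup_m F m); split.
- exact: bigcupT_measurable.
- have cvgF : (lebesgue_measure (F m) @[m --> \oo] -->
      lebesgue_measure (\bigcup_m F m))%E.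
    apply: nondecreasing_cvg_mu => //; first exact: bigcupT_measurable.
    move=> m n mn; apply/subsetPset => x Fx k /= nk.
    by apply: Fx => /=; exact: leq_trans nk.
  rewrite -(cvg_lim _ cvgF) //; apply: lime_le;
    first by apply/cvg_ex; eexists; exact: cvgF.
  near=> m; have [mA leA _] := hA m.
  apply: le_trans leA; apply: le_measure;
    [exact: (mem_set (mF m)) | exact: (mem_set mA) |].
  by move=> x /(_ m (leqnn m)).
- move=> t phi1; have dt := delta_gt0 t.
  exists (Num.truncn (2 / delta t)) => // n /= le_n.
  have [_ _] := hA n; apply=> //.
  rewrite ler_pdivrMr // mulrC -ler_pdivrMr //.
  apply: ltW; apply: lt_le_trans (truncnS_gt _) _.
  by rewrite ler_nat.
Unshelve. all: by end_near.
Qed.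

End UpperSums.

(** * Semi-norm distances and sequences with summable steps *)

Section Seminorm.
Context {R : realType} {X : lmodType R} {rho : X -> R}.
Hypothesis hrho : seminorm rho.
Local Notation dist := (seminorm_dist rho).

Lemma seminorm_ge0 x : 0 <= rho x.
Proof. by have [] := hrho. Qed.

Lemma seminorm_distC x y : dist x y = dist y x.
Proof.
have [_ _ rhoZ] := hrho.
by rewrite /seminorm_dist -(opprB y x) -(scaleN1r (y - x)) rhoZ normrN1 mul1r.
Qed.

Lemma seminorm_dist_triangle y x z : dist x z <= dist x y + dist y z.
Proof.
have [_ rhoD _] := hrho; rewrite /seminorm_dist.
by rewrite (le_trans _ (rhoD _ _)) // addrA subrK.
Qed.

Lemma seminorm_dist_le_sum (x : nat -> X) m n :
  dist (x (m + n)%N) (x m) <= \sum_(j < n) dist (x (m + j).+1) (x (m + j)%N).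
Proof.
elim: n => [|n IHn].
  have [_ _ /(_ 0 0)] := hrho; rewrite scale0r normr0 mul0r => rho0.
  by rewrite big_ord0 addn0 /seminorm_dist subrr rho0.
rewrite big_ord_recr addnS.
rewrite (le_trans (seminorm_dist_triangle (x (m + n)%N) _ _)) //.
by rewrite [leRHS]addrC lerD.
Qed.

Lemma summable_steps_cauchy (x : nat -> X) (eps : nat -> R) K :
  (forall k, 0 <= eps k) -> cvgn (series eps) ->
  (forall k, (K <= k)%N -> dist (x k.+1) (x k) <= eps k) ->
  seq_cauchy dist x.
Proof.
move=> eps_ge0 cvg_eps step e e_gt0.
have e2_gt0 : 0 < e / 2 by rewrite divr_gt0.
move/cvgrPdist_lt : cvg_eps => /(_ _ e2_gt0) [N _ hN].
(* Beyond [N] the partial sums are within [e / 2] of their limit, hence within [e] of each other;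
   beyond [K] they control the steps. *)
exists (maxn K N) => m n; wlog mn : m n / (m <= n)%N => [hwlog|].
  have [/hwlog//|/ltnW nm hm hn] := leqP m n.
  by rewrite seminorm_distC; exact: hwlog.
rewrite !geq_max => /andP[Km Nm] /andP[Kn Nn].
rewrite seminorm_distC -(subnKC mn).
apply: le_lt_trans (seminorm_dist_le_sum x m (n - m)) _.
have le_sum : \sum_(j < n - m) dist (x (m + j).+1) (x (m + j)%N) <=
    series eps n - series eps m.
  rewrite sub_series mn -[X in \sum_(X <= _ < _) _]add0n big_addn big_mkord.
  apply: ler_sum => j _; rewrite (addnC j); apply: step.
  exact: leq_trans (leq_addr _ _).
apply: le_lt_trans le_sum _.
have := hN _ Nm; have := hN _ Nn; rewrite !ltr_norml.
by move=> /andP[? ?] /andP[? ?]; lra.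
Qed.

End Seminorm.

(** * From the semi-norm of [Up] to upper sums and back *)

Section UpSpace.
Context {R : realType} {a b : R} {X : lmodType R} {rho : X -> R} {p : R}.
Hypotheses (ab : a < b) (hrho : seminorm rho) (p_ge1 : 1 <= p).
Local Notation dist := (seminorm_dist rho).
Implicit Types f g h : `[a, b]%classic -> X.

Let p_gt0 : 0 < p. Proof. exact: lt_le_trans p_ge1. Qed.
Let p_ge0 : 0 <= p. Proof. exact: ltW. Qed.

(** The strict inequality produces a gauge, since the infimum need not be attained. *)
Lemma mu_p_lt_upper_sums f c : (mu_p rho p f < c%:E)%E ->
  upper_sums_le (fun t => rho (f t) `^ p) c.
Proof.
move=> /ereal_inf_lt [_ [delta delta_gt0 ->] /ltW sup_le].
exists delta => // D partD fineD; rewrite -lee_fin.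
by apply: le_trans sup_le; apply: ereal_sup_ubound; exists D.
Qed.

Lemma upper_sums_mu_p_le f c : upper_sums_le (fun t => rho (f t) `^ p) c ->
  (mu_p rho p f <= c%:E)%E.
Proof.
move=> [delta delta_gt0 sum_le].
apply: ge_ereal_inf; eexists; first by exists delta.
by apply: ge_ereal_sup => _ [D [partD fineD] <-]; rewrite lee_fin sum_le.
Qed.

(** Cousin's lemma makes each supremum range over a nonempty set, so none of them is [-oo]. *)
Lemma mu_p_ge0 f : (0 <= mu_p rho p f)%E.
Proof.
apply: le_ereal_inf_tmp => _ [delta delta_gt0 ->].
have [D partD fineD] := cousin delta_gt0 (lexx a) ab (lexx b).
apply: le_ereal_sup_tmp; exists (riemann_sum (fun t => rho (f t) `^ p) D)%:E.
  by exists D.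
have [lr _ _ _] := partD; rewrite lee_fin; apply: sumr_ge0 => i _.
by rewrite mulr_ge0 ?powR_ge0 // subr_ge0 ltW.
Qed.

Lemma Up_upper_sums f :
  Up a b rho p f <-> exists c, upper_sums_le (fun t => rho (f t) `^ p) c.
Proof.
rewrite /Up /=; split=> [lt_oo|[c /upper_sums_mu_p_le]]; last first.
  by move/le_lt_trans; apply; rewrite ltry.
exists (fine (mu_p rho p f) + 1); apply: mu_p_lt_upper_sums.
rewrite -[ltLHS]fineK ?lte_fin ?ltrDl //.
by rewrite ge0_fin_numE // mu_p_ge0.
Qed.

Lemma Up_norm_lt_upper_sums f e : Up a b rho p f -> Up_norm rho p f < e ->
  upper_sums_le (fun t => rho (f t) `^ p) (e `^ p).
Proof.
rewrite /Up /= /Up_norm => lt_oo lt_e; apply: mu_p_lt_upper_sums.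
have mu_ge0 := mu_p_ge0 f.
rewrite -[ltLHS]fineK ?ge0_fin_numE // lte_fin.
have fine_ge0 := fine_ge0 mu_ge0.
rewrite -[ltLHS]powRr1 // -(mulVf (lt0r_neq0 p_gt0)) powRrM.
by apply: gt0_ltr_powR; rewrite ?nnegrE ?powR_ge0 //
  (le_trans _ (ltW lt_e)) ?powR_ge0.
Qed.

Lemma upper_sums_Up_norm_le f c : 0 <= c ->
  upper_sums_le (fun t => rho (f t) `^ p) (c `^ p) -> Up_norm rho p f <= c.
Proof.
move=> c_ge0 /upper_sums_mu_p_le le_c; have mu_ge0 := mu_p_ge0 f.
rewrite /Up_norm -[leRHS]powRr1 // -(mulfV (lt0r_neq0 p_gt0)) powRrM.
apply: ge0_ler_powR; rewrite ?nnegrE ?invr_ge0 ?powR_ge0 ?fine_ge0 //.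
rewrite -lee_fin fineK // ge0_fin_numE //.
by rewrite (le_lt_trans le_c) // ltry.
Qed.

(** The sum is at most twice the larger term. The constant is harmless, as only smallness of the
    norms matters later. *)
Lemma powRD_le (x y : R) : 0 <= x -> 0 <= y ->
  (x + y) `^ p <= 2 `^ p * (x `^ p + y `^ p).
Proof.
move=> x0 y0.
wlog xy : x y x0 y0 / x <= y => [hwlog|].
  by have [/hwlog|/ltW/hwlog] := leP x y;
    last rewrite addrC [X in _ * X]addrC; apply.
apply: (@le_trans _ _ ((2 * y) `^ p)).
  by apply: ge0_ler_powR; rewrite ?nnegrE ?addr_ge0 ?mulr_ge0 //; lra.
by rewrite powRM // ler_wpM2l ?powR_ge0 // lerDr powR_ge0.
Qed.

Lemma upper_sums_le_dist_triangle g f h c d :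
  upper_sums_le (fun t => dist (f t) (g t) `^ p) c ->
  upper_sums_le (fun t => dist (g t) (h t) `^ p) d ->
  upper_sums_le (fun t => dist (f t) (h t) `^ p) (2 `^ p * (c + d)).
Proof.
move=> fg gh.
apply: upper_sums_le_trans (upper_sums_leZ _ _ _ (powR_ge0 2 p)
  (upper_sums_leD _ _ _ _ fg gh)) => // t.
apply: le_trans (powRD_le _ _ (seminorm_ge0 hrho _) (seminorm_ge0 hrho _)).
apply: ge0_ler_powR => //; rewrite ?nnegrE ?addr_ge0 ?(seminorm_ge0 hrho) //.
exact: seminorm_dist_triangle.
Qed.

Lemma Up_dist_lt_upper_sums (f g : Up a b rho p) e :
  Up_dist a b rho p f g < e ->
  upper_sums_le (fun t => dist (\val f t) (\val g t) `^ p) (e `^ p).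
Proof.
(* The difference must first be shown to lie in [Up], since [fine] would turn an infinite value into
   0. The triangle goes through the zero function. *)
apply: Up_norm_lt_upper_sums; apply/Up_upper_sums.
have /Up_upper_sums [c hc] := set_mem (valP f).
have /Up_upper_sums [d hd] := set_mem (valP g).
exists (2 `^ p * (c + d)).
apply: (upper_sums_le_dist_triangle (fun=> 0)).
  by apply: upper_sums_le_trans hc => // t; rewrite /seminorm_dist subr0.
apply: upper_sums_le_trans hd => // t.
by rewrite seminorm_distC // /seminorm_dist subr0.
Qed.

(** Chebyshev's inequality in normalised form. Division by [w] leaves the bound [w ^ p], at most [w]
    because [w <= 1 <= p]; this is where the square in the rapid Cauchy condition is spent. *)
Lemma upper_sums_rescale (h : `[a, b]%classic -> R) w : 0 < w -> w <= 1 ->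
  (forall t, 0 <= h t) -> upper_sums_le (fun t => h t `^ p) ((w ^+ 2) `^ p) ->
  upper_sums_le (fun t => (h t / w) `^ p) w.
Proof.
move=> w_gt0 w_le1 h_ge0 /(upper_sums_leZ (w^-1 `^ p) _ _ (powR_ge0 _ _)).
have w_ge0 := ltW w_gt0; have wV_ge0 : 0 <= w^-1 by rewrite invr_ge0.
apply: upper_sums_le_trans => [t|].
  by rewrite powRM // mulrC.
rewrite -powRM ?exprn_ge0 // expr2 mulrA mulVf ?gt_eqF // mul1r.
by apply: ge1r_powR; rewrite ?w_gt0.
Qed.

End UpSpace.

(** * Almost everywhere convergence of rapidly Cauchy sequences *)

Section RapidlyCauchy.
Context {R : realType} {a b : R} {X : lmodType R} {rho : X -> R} {p : R}.
Hypotheses (ab : a < b) (hrho : seminorm rho) (p_ge1 : 1 <= p).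
Local Notation dist := (seminorm_dist rho).
Variables (g : nat -> `[a, b]%classic -> X) (eps : nat -> R).
Hypotheses (eps_gt0 : forall k, 0 < eps k) (eps_cvg : cvgn (series eps)).
Hypothesis g_rapid : forall k,
  upper_sums_le (fun t => dist (g k.+1 t) (g k t) `^ p) ((eps k ^+ 2) `^ p).

Let p_gt0 : 0 < p. Proof. exact: lt_le_trans p_ge1. Qed.
Let p_ge0 : 0 <= p. Proof. exact: ltW. Qed.

(** Normalised so that the threshold [eps k] for the step becomes the level 1 of the superlevel
    lemmas. *)
Definition step_ratio k (t : `[a, b]%classic) : R :=
  (dist (g k.+1 t) (g k t) / eps k) `^ p.

Lemma step_ratio_ge0 k t : 0 <= step_ratio k t.
Proof. exact: powR_ge0. Qed.

Lemma upper_sums_step_ratio k : eps k <= 1 ->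
  upper_sums_le (step_ratio k) (eps k).
Proof.
move=> eps_le1; apply: upper_sums_rescale => // t; exact: (seminorm_ge0 hrho).
Qed.

Lemma step_ratio_lt1 k t :
  step_ratio k t < 1 -> dist (g k.+1 t) (g k t) <= eps k.
Proof.
move=> lt1; rewrite leNgt; apply/negP => eps_lt; move: lt1; rewrite ltNge.
move/negP; apply; have -> : 1 = 1 `^ p by rewrite powR1.
have dist_ge0 := seminorm_ge0 hrho (g k.+1 t - g k t).
apply: ge0_ler_powR => //; rewrite ?nnegrE //.
  by rewrite divr_ge0 // ltW.
by rewrite ler_pdivlMr // mul1r ltW.
Qed.

Lemma step_ratio_cauchy K t : (forall k, (K <= k)%N -> step_ratio k t < 1) ->
  seq_cauchy dist (g^~ t).
Proof.
move=> lt1; apply: (summable_steps_cauchy hrho _ eps K) => // k.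
  exact: ltW.
by move=> /lt1/step_ratio_lt1.
Qed.

Lemma rapidly_cauchy_pointwise_cauchy_ae : pointwise_cauchy_ae rho g.
Proof.
(* The rescaled bound asks for [eps k <= 1], which holds only eventually; hence the shift by [K]
   below. *)
have [K _ eps_le1] : \forall k \near \oo, eps k <= 1.
  move/cvg_series_cvg_0/cvgrPdist_le : eps_cvg => /(_ _ ltr01).
  by apply: filterS => k; rewrite sub0r normrN ger0_norm // ltW.
have [B hB] := choice (fun j => superlevel_measurable_cover _ _ ab
  (step_ratio_ge0 (K + j)%N)
  (upper_sums_step_ratio (K + j)%N (eps_le1 _ (leq_addr j K)))).
(* Borel-Cantelli: the measures of the covers are bounded by a tail of the convergent series. *)
have lim_sup0 : lebesgue_measure (lim_sup_set B) = 0%E.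
  apply: lim_sup_set_cvg0; first by move=> j; have [] := hB j.
  apply: (@le_lt_trans _ _ (limn (series eps))%:E); last exact: ltry.
  apply: lime_le; first by apply: is_cvg_nneseries => *; exact: measure_ge0.
  near=> n; apply: (@le_trans _ _ (\sum_(0 <= j < n) eps (K + j)%N)%:E).
    by rewrite -sumEFin; apply: lee_sum => j _; have [] := hB j.
  have nd_eps : nondecreasing_seq (series eps).
    by apply: nondecreasing_series => k _ _; exact: ltW.
  rewrite lee_fin.
  apply: le_trans (nondecreasing_cvgn_le nd_eps eps_cvg (n + K)).
  rewrite series_addn -{3}[K]add0n big_addn addnK.
  under eq_bigr do rewrite addnC.
  by rewrite lerDr; apply: sumr_ge0 => k _; exact: ltW.
exists (`[a, b]%classic `&` lim_sup_set B); split=> [x []//||t nEt].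
  exists (lim_sup_set B); split=> //.
  rewrite /lim_sup_set; apply: bigcap_measurableType => n _.
  by apply: bigcup_measurable => j _; have [] := hB j.
have [n nB] : exists n, forall j, (n <= j)%N -> ~ B j (\val t).
  apply: contrapT => /forallNP nex; apply: nEt.
  split; first exact: set_mem (valP t).
  move=> n _; have /existsNP [j /not_implyP [nj /contrapT Bj]] := nex n.
  by exists j.
apply: (step_ratio_cauchy (K + n)) => k le_k; rewrite ltNge; apply/negP => ge1.
have Kk : (K <= k)%N by exact: leq_trans (leq_addr _ _) le_k.
apply: (nB (k - K)%N); first by rewrite leq_subRL.
by have [_ _] := hB (k - K)%N; rewrite subnKC //; apply.
Unshelve. all: by end_near.
Qed.


(** * Distance to the pointwise limit *)

Section Limit.
(** [tail K] majorises the tail of the series from [K] on. Nothing is prescribed for [f] at points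
    of divergence. *)
Variables (f : `[a, b]%classic -> X) (tail : nat -> R).
Hypothesis eps_le_tail : forall K n, \sum_(j < n) eps (K + j)%N <= tail K.
Hypothesis tail_le1 : forall K, tail K <= 1.
Hypothesis tail_small : forall e, 0 < e -> exists K, tail K < e.
Hypothesis f_lim : forall t, seq_cauchy dist (g^~ t) ->
  seq_converges dist (g^~ t) (f t).

Let eps_le1 k : eps k <= 1.
Proof.
by have := eps_le_tail k 1; rewrite big_ord1 addn0 => /le_trans; apply.
Qed.

Let divergent t := ~~ `[< seq_cauchy dist (g^~ t) >].

(** At a point of divergence every tail contains a step ratio of at least 1, so these ratios
    dominate the indicator, with total at most [tail K]. *)
Lemma upper_sums_divergent e : 0 < e ->
  upper_sums_le (fun t => (divergent t)%:R) e.
Proof.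
move=> e_gt0; have [K /ltW tail_le] := tail_small _ e_gt0.
apply: (@upper_sums_le_countable _ _ _ _ (fun j => step_ratio (K + j))
  (fun j => eps (K + j)%N)).
- by move=> j t; exact: step_ratio_ge0.
- move=> t; rewrite /divergent; case: asboolP => /= [_|not_cauchy].
    by exists 0%N; exact: step_ratio_ge0.
  apply: contrapT => /forallNP lt1; apply: not_cauchy.
  apply: (step_ratio_cauchy K) => k le_k.
  by have /negP := lt1 (k - K)%N; rewrite subnKC // -ltNge.
- by move=> j; exact: upper_sums_step_ratio.
- by move=> n; exact: le_trans (eps_le_tail K n) tail_le.
Qed.

(* If every step g (K + j + 1) - g (K + j) were less than eps (K + j) / 2 times
   the distance r from g K to the limit, the steps would add up to at most
   r / 2. *)
Lemma dist_limit_le_step_ratio K t : seq_cauchy dist (g^~ t) ->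
  exists j, dist (g K t) (f t) `^ p <= 2 `^ p * step_ratio (K + j) t.
Proof.
move=> /f_lim lim_t; apply: contrapT => /forallNP far.
pose r := dist (g K t) (f t).
have step_lt j :
    dist (g (K + j).+1 t) (g (K + j)%N t) < eps (K + j)%N * (r / 2).
  rewrite ltNge; apply/negP => le_step; apply: (far j).
  have step_ge0 := seminorm_ge0 hrho (g (K + j).+1 t - g (K + j)%N t).
  have ratio_ge0 : 0 <= dist (g (K + j).+1 t) (g (K + j)%N t) / eps (K + j)%N.
    by rewrite divr_ge0 // ltW.
  rewrite -powRM //; apply: ge0_ler_powR => //;
    rewrite ?nnegrE ?(mulr_ge0 _ ratio_ge0) //.
    exact: (seminorm_ge0 hrho).
  rewrite -/r mulrA ler_pdivlMr //; lra.
(* A nonnegative step lies strictly below a positive multiple of [r]. *)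
have r_gt0 : 0 < r.
  have := le_lt_trans (seminorm_ge0 hrho _) (step_lt 0%N).
  by rewrite pmulr_rgt0 // pmulr_lgt0 // invr_gt0.
have r2_gt0 : 0 < r / 2 by rewrite divr_gt0.
(* Some [g (K + N)] is closer than [r / 2] to the limit and at most [r / 2] from [g K], which
   contradicts the triangle inequality. *)
move/cvgrPdist_lt : lim_t => /(_ _ r2_gt0) [N _ /(_ (K + N)%N (leq_addl _ _))].
rewrite sub0r normrN ger0_norm; last exact: (seminorm_ge0 hrho).
have := seminorm_dist_triangle hrho (g (K + N)%N t) (g K t) (f t).
have := seminorm_dist_le_sum hrho (g^~ t) K N.
rewrite (seminorm_distC hrho (g (K + N)%N t)) -/r.
have : \sum_(j < N) dist (g (K + j).+1 t) (g (K + j)%N t) <= r / 2.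
  apply: le_trans (ler_sum _ (fun (j : 'I_N) _ => ltW (step_lt j))) _.
  rewrite -mulr_suml ler_piMl ?(ltW r2_gt0) //.
  exact: le_trans (eps_le_tail K N) (tail_le1 K).
lra.
Qed.

Lemma upper_sums_dist_limit K :
  upper_sums_le (fun t => dist (g K t) (f t) `^ p) ((2 `^ p + 1) * tail K).
Proof.
pose phi t := dist (g K t) (f t) `^ p.
have phi_ge0 t : 0 <= phi t by exact: powR_ge0.
have pow2_ge0 : 0 <= 2 `^ p :> R by exact: powR_ge0.
have good : upper_sums_le (fun t => (~~ divergent t)%:R * phi t)
    (2 `^ p * tail K).
  apply: (@upper_sums_le_countable _ _ _ _
    (fun j t => 2 `^ p * step_ratio (K + j) t)
    (fun j => 2 `^ p * eps (K + j)%N)).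
  - by move=> j t; rewrite mulr_ge0 // step_ratio_ge0.
  - move=> t; rewrite /divergent negbK; case: asboolP => /= [cauchy_t|_].
      rewrite mul1r; exact: dist_limit_le_step_ratio.
    by exists 0%N; rewrite mul0r mulr_ge0 // step_ratio_ge0.
  - by move=> j; apply: upper_sums_leZ => //; exact: upper_sums_step_ratio.
  - by move=> n; rewrite -mulr_sumr ler_wpM2l.
(* [phi] may be unbounded on the divergence set, so it is dominated there by the multiples [m + 1]
   of the indicator. Each multiple is given the budget [eps (K + m)], so that the total is again at
   most [tail K]. *)
have bad : upper_sums_le (fun t => (divergent t)%:R * phi t) (tail K).
  apply: (@upper_sums_le_countable _ _ _ _
    (fun m t => m.+1%:R * (divergent t)%:R) (fun m => eps (K + m)%N)).
  - by move=> m t; rewrite mulr_ge0.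
  - move=> t; exists (Num.truncn (phi t)); rewrite mulrC ler_wpM2r //.
    exact/ltW/truncnS_gt.
  - move=> m; have e_gt0 : 0 < eps (K + m)%N / m.+1%:R by rewrite divr_gt0.
    rewrite -[eps _](divfK (_ : m.+1%:R != 0)) // mulrC.
    by apply: upper_sums_leZ => //; exact: upper_sums_divergent.
  - exact: eps_le_tail.
apply: upper_sums_le_trans (upper_sums_leD _ _ _ _ good bad) => [t|].
  by rewrite -mulrDl -/(phi t) -[leLHS]mul1r;
    case: (divergent t); rewrite ?addr0 ?add0r.
by rewrite mulrDl mul1r.
Qed.

End Limit.
End RapidlyCauchy.

(** * Completeness by way of a geometric subsequence *)

Lemma sum_half_pow (R : realType) K n :
  \sum_(j < n) (2^-1 : R) ^+ (K + j).+1 = 2^-1 ^+ K - 2^-1 ^+ (K + n).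
Proof.
elim: n => [|n IHn]; first by rewrite big_ord0 addn0 subrr.
by rewrite big_ord_recr /= IHn addnS exprS; lra.
Qed.

Lemma exists_half_pow_lt (R : realType) (e : R) : 0 < e ->
  exists K, 2^-1 ^+ K < e.
Proof.
have half_lt1 : `|2^-1 : R| < 1 by rewrite ger0_norm; lra.
move=> e_gt0; have /cvgrPdist_lt /(_ _ e_gt0) := cvg_geometric (1 : R) half_lt1.
move=> [K _ /(_ K (leqnn K))]; rewrite /= sub0r normrN mul1r => h; exists K.
exact: le_lt_trans (ler_norm _) h.
Qed.

Lemma Up_sequentially_complete (R : realType) (a b : R) (X : lmodType R)
    (rho : X -> R) (p : R) : a < b -> seminorm rho -> 1 <= p ->
  sequentially_complete (seminorm_dist rho) ->
  sequentially_complete (Up_dist a b rho p).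
Proof.
move=> ab hrho hp complete F cauchyF.
pose w k : R := 2^-1 ^+ k.+1.
have w_gt0 k : 0 < w k by rewrite exprn_gt0.
have w_cvg : cvgn (series w).
  have -> : w = geometric 2^-1 2^-1 by apply/funext => k /=; rewrite /w exprS.
  by apply: is_cvg_geometric_series; rewrite ger0_norm; lra.
have [N hN] := choice (fun k => cauchyF _ (exprn_gt0 2 (w_gt0 k))).
(* The running maximum puts both [M k] and [M k.+1] beyond [N k], so consecutive terms of [g] are
   closer than the square of [w k]. *)
pose M k := (\max_(i < k.+1) N i)%N.
have N_le_M k : (N k <= M k)%N.
  exact: (leq_bigmax (F := fun i : 'I_k.+1 => N i) ord_max).
have N_le_MS k : (N k <= M k.+1)%N.
  by rewrite (leq_trans (N_le_M k)) // /M [leqRHS]big_ord_recr leq_maxl.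
pose g k := \val (F (M k)).
have g_rapid k : upper_sums_le
    (fun t => seminorm_dist rho (g k.+1 t) (g k t) `^ p)
    ((w k ^+ 2) `^ p).
  by apply: (Up_dist_lt_upper_sums ab hrho hp); exact: hN.
have [f f_lim] : {f : `[a, b]%classic -> X | forall t,
    seq_cauchy (seminorm_dist rho) (g^~ t) ->
    seq_converges (seminorm_dist rho) (g^~ t) (f t)}.
  have H t : exists x, seq_cauchy (seminorm_dist rho) (g^~ t) ->
      seq_converges (seminorm_dist rho) (g^~ t) x.
    have [/complete [x hx]|nc] :=
      pselect (seq_cauchy (seminorm_dist rho) (g^~ t)).
      by exists x.
    by exists 0.
  by have [f hf] := choice H; exists f.
have half_ge0 k : 0 <= (2^-1 : R) ^+ k by rewrite exprn_ge0.
have half_le1 k : (2^-1 : R) ^+ k <= 1 by apply: exprn_ile1; lra.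
have g_f K := upper_sums_dist_limit hrho hp g w w_gt0 w_cvg g_rapid f
  (fun K => 2^-1 ^+ K)
  (fun K n => ltac:(by rewrite sum_half_pow gerBl)) half_le1
  (@exists_half_pow_lt R) f_lim K.
have Up_f : Up a b rho p f.
  apply/(Up_upper_sums ab).
  (* Membership of [f] follows from that of [g 0] and the bound on their distance. *)
  have /(Up_upper_sums ab) [c g0_le] := set_mem (valP (F (M 0%N))).
  have f_g0 : upper_sums_le (fun t => seminorm_dist rho (f t) (g 0%N t) `^ p)
      ((2 `^ p + 1) * 2^-1 ^+ 0).
    by apply: upper_sums_le_trans (g_f 0%N) => // t; rewrite seminorm_distC.
  have g0_0 : upper_sums_le (fun t => seminorm_dist rho (g 0%N t) 0 `^ p) c.
    by apply: upper_sums_le_trans g0_le => // t; rewrite /seminorm_dist subr0.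
  eexists; apply: upper_sums_le_trans (lexx _)
    (upper_sums_le_dist_triangle hrho hp _ _ (fun=> 0) _ _ f_g0 g0_0) => t.
  by rewrite /seminorm_dist subr0.
exists (exist _ f (mem_set Up_f)).
have p_gt0 : 0 < p by exact: lt_le_trans hp.
apply/cvgrPdist_le => e e_gt0.
(* The factor [2 ^ p] is from the triangle inequality for powers; 1 pays for the distance from [F n]
   to [g K], and [2 ^ p + 1] for that from [g K] to [f]. *)
pose C : R := 2 `^ p * (1 + (2 `^ p + 1)).
have C_gt0 : 0 < C.
  by rewrite mulr_gt0 ?powR_gt0 // !addr_gt0 ?powR_gt0.
have [K] : exists K, 2^-1 ^+ K < e `^ p / C.
  by apply: exists_half_pow_lt; rewrite divr_gt0 ?powR_gt0.
rewrite ltr_pdivlMr // => /ltW K_le.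
(* Every [F n] with [n] beyond [N K] is close to [g K], so the whole sequence converges along with
   the subsequence. *)
exists (N K) => // n /= Nn.
rewrite sub0r normrN ger0_norm ?powR_ge0 //.
apply: (upper_sums_Up_norm_le ab hp); first exact: ltW.
have F_g := Up_dist_lt_upper_sums ab hrho hp _ _ _ (hN K n (M K) Nn (N_le_M K)).
apply: upper_sums_le_trans
  (upper_sums_le_dist_triangle hrho hp _ _ _ _ _ F_g (g_f K)) => //.
apply: le_trans K_le; rewrite [leRHS]mulrC /C -mulrA ler_wpM2l ?powR_ge0 //.
rewrite [leRHS]mulrDl mul1r lerD2r.
(* The bound for [F n] is at most [w K ^+ 2], which is 2 to the power [-(2K + 2)] and so at most the
   required 2 to the power [-K]. *)
have w2_le1 : w K ^+ 2 <= 1 by exact: exprn_ile1 (ltW (w_gt0 K)) (half_le1 _).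
apply: (@le_trans _ _ (w K ^+ 2)).
  by apply: ge1r_powR; rewrite ?exprn_gt0 ?w2_le1.
rewrite -exprM; apply: ler_wiXn2l => //; first by lra.
by rewrite muln2 -addnn addSn ltnW // ltnS leq_addr.
Qed.

Theorem theorem9 (R : realType) (a b : R) (hab : a < b)
    (X : lmodType R) (rho : X -> R) (hrho : seminorm rho)
    (p : R) (hp : 1 <= p) :
  (forall f : nat -> Up a b rho p,
     seq_rapidly_cauchy (Up_dist a b rho p) f ->
     pointwise_cauchy_ae rho (fun n => \val (f n)))
  /\
  (sequentially_complete (seminorm_dist rho) ->
   sequentially_complete (Up_dist a b rho p)).
Proof.
split=> [f [eps [eps_gt0 eps_cvg f_rapid]]|];
  last exact: Up_sequentially_complete.
apply: (rapidly_cauchy_pointwise_cauchy_ae hab hrho hp _ eps) => // k.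
exact: (Up_dist_lt_upper_sums hab hrho hp).
Qed.
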